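(* Let $p$ be a prime number and let $r \in \mathbb{Z}^{+}$ be a positive integer. Then: (1) if $p = 4r+1$ and $p \neq 5$, then $p$ divides the product $F_{2r}F_{2r+1}$; (2) if $p = 4r+3$, then $p$ divides the product $L_{2r+1}L_{2r+2}$.
   Context: $F_n$ denotes the $n$-th Fibonacci number, defined by $F_0 = 0$, $F_1 = 1$, $F_{n+2} = F_{n+1} + F_n$. $L_n$ denotes the $n$-th Lucas number, defined by $L_0 = 2$, $L_1 = 1$, $L_{n+2} = L_{n+1} + L_n$. *)

(* Defs.v *)
From mathcomp Require Import all_boot.

Set Implicit Arguments.
Unset Strict Implicit.
Unset Printing Implicit Defensive.

Fixpoint fib (n : nat) : nat :=
  match n with
  | 0 => 0
  | 1 => 1
  | (m.+1 as k).+1 => fib k + fib m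
  end.

Fixpoint lucas (n : nat) : nat :=
  match n with
  | 0 => 2
  | 1 => 1
  | (m.+1 as k).+1 => lucas k + lucas m
  end.

(* Main.v *)
Require Import Defs.
From mathcomp Require Import all_boot.
From mathcomp Require Import all_algebra ring.

(** Both products are, up to the factor 5, equal to L_p - 1.  Indeed Cassini's
    identity and the doubling formula for L_(2n+1) give

      5 F_n F_(n+1) = L_(2n+1) - (-1)^n   and   L_n L_(n+1) = L_(2n+1) + (-1)^n,

    and 2n+1 = p for n = 2r even in the first case and for n = 2r+1 odd in the
    second case.  Hence everything rests on the congruence L_p = 1 modulo p
    ([lucas_prime]).  By Binet's formula L_p = a^p + b^p, where a and b = 1 - a
    are the roots of X^2 - X - 1, and in characteristic p the Frobenius map
    turns this into (a + b)^p = 1.  The roots are realized as 2 x 2 matrices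
    over 'F_p, which avoids extending the field when 5 is not a square.  In
    the first case the factor 5 is cancelled, which is where p != 5 enters. *)

Import GRing.Theory.
Local Open Scope ring_scope.

Lemma fibSS n : fib n.+2 = (fib n.+1 + fib n)%N.
Proof. by []. Qed.

Lemma lucasSS n : lucas n.+2 = (lucas n.+1 + lucas n)%N.
Proof. by []. Qed.

Section ProductIdentities.

Variable R : comNzRingType.

Local Notation F n := ((fib n)%:R : R).
Local Notation L n := ((lucas n)%:R : R).

Lemma fib_cassini n : F n.+1 ^+ 2 - F n * F n.+1 - F n ^+ 2 = (-1) ^+ n.
Proof.
elim: n => [|n IHn]; first by rewrite expr0 /=; ring.
by rewrite fibSS natrD [RHS]exprS -IHn; ring.
Qed.

(** Both sides satisfy the second-order Fibonacci recurrence; proving two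
    consecutive indices at once makes plain induction sufficient. *)
Lemma lucas_fib n :
  L n = 2 * F n.+1 - F n /\ L n.+1 = 2 * F n + F n.+1.
Proof.
elim: n => [|n [IHn IHn1]]; first by split; rewrite /=; ring.
by split; rewrite ?IHn1 ?lucasSS fibSS !natrD ?IHn ?IHn1; ring.
Qed.

Lemma lucas_add m n : L (m + n).+1 = F m.+1 * L n.+1 + F m * L n.
Proof.
elim: m n => [|m IHm] n; first by rewrite add0n /=; ring.
by rewrite addSnnS IHm lucasSS fibSS !natrD; ring.
Qed.

Lemma lucas_double n : L n.*2.+1 = F n.+1 ^+ 2 + 4 * F n * F n.+1 - F n ^+ 2.
Proof.
by rewrite -addnn lucas_add; have [-> ->] := lucas_fib n; ring.
Qed.

Lemma fib_mul_succ n : 5 * (F n * F n.+1) = L n.*2.+1 - (-1) ^+ n.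
Proof. by rewrite lucas_double -fib_cassini; ring. Qed.

Lemma lucas_mul_succ n : L n * L n.+1 = L n.*2.+1 + (-1) ^+ n.
Proof.
by rewrite lucas_double -fib_cassini; have [-> ->] := lucas_fib n; ring.
Qed.

End ProductIdentities.

(** Binet's formula: the other root of X^2 - X - 1 is 1 - a.  Commutativity of
    the ring is not assumed, so that a may be a matrix. *)
Lemma lucas_binet (R : nzRingType) (a : R) n :
  a ^+ 2 = a + 1 -> a ^+ n + (1 - a) ^+ n = (lucas n)%:R.
Proof.
move=> a2; set b := 1 - a.
have b2 : b ^+ 2 = b + 1.
  rewrite expr2 {2}/b mulrBr mulr1 {2}/b mulrBl mul1r -expr2 a2.
  by rewrite opprB addrC [a + 1]addrC addrK addrC.
have ab1 : a + b = 1 by rewrite addrC subrK.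
(* Opaque from here on, so that distributivity does not expand b. *)
clearbody b; suff [] : a ^+ n + b ^+ n = (lucas n)%:R /\
          a ^+ n.+1 + b ^+ n.+1 = (lucas n.+1)%:R by [].
elim: n => [|n [IHn IHn1]]; first by split; rewrite ?expr1.
split=> //; rewrite lucasSS natrD -IHn -IHn1.
by rewrite -[n.+2]addn2 !exprD a2 b2 !mulrDr !mulr1 -!exprSr addrACA.
Qed.

(** The Fibonacci matrix A is a root of X^2 - X - 1 and commutes with 1 - A, so
    that the Frobenius map is additive on this pair although the matrix ring is
    not commutative. *)
Lemma lucas_prime p : prime p -> (lucas p)%:R = 1 :> 'F_p.
Proof.
move=> p_pr.
pose A : 'M['F_p]_2 := \matrix_(i, j) ((i == 0) || (j == 0))%:R.
have A2 : A ^+ 2 = A + 1.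
  apply/matrixP=> i j; rewrite expr2 !mxE !big_ord_recl big_ord0 !mxE.
  by case: i => [[|[|[]]] //= ?]; case: j => [[|[|[]]] //= ?]; ring.
have p_char : p \in [pchar 'M['F_p]_2].
  by rewrite inE p_pr -scaler_nat pchar_Fp_0 // scale0r eqxx.
have := lucas_binet _ _ p A2.
rewrite -!(pFrobenius_autE p_char) -pFrobenius_autD_comm; last first.
  by apply: commrB; [apply: commr1 | apply: commr_refl].
rewrite addrC subrK pFrobenius_aut1 => /matrixP/(_ 0 0).
by rewrite -scaler_nat !mxE eqxx mulr1.
Qed.

Local Close Scope ring_scope.

Theorem theorem1 (p r : nat) (hp : prime p) (hr : 0 < r) :
  (p = 4 * r + 1 -> p <> 5 -> p %| fib (2 * r) * fib (2 * r + 1)) /\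
  (p = 4 * r + 3 -> p %| lucas (2 * r + 1) * lucas (2 * r + 2)).
Proof.
have dvdE n : (p %| n) = (n%:R == 0 :> 'F_p)%R.
  by rewrite (dvdn_pcharf (pchar_Fp hp)).
have Lp := lucas_prime _ hp; split=> [pE p_neq5 | pE].
- have five_neq0 : (5 != 0 :> 'F_p)%R.
    by rewrite -dvdE dvdn_prime2 //; apply/eqP.
  have pE2 : p = (2 * r).*2.+1 by rewrite pE addn1 -muln2 mulnAC.
  rewrite dvdE natrM addn1 -(mulrI_eq0 _ (mulfI five_neq0)) fib_mul_succ.
  by rewrite -pE2 Lp exprM sqrrN expr1n expr1n subrr.
- have pE2 : p = (2 * r).+1.*2.+1.
    by rewrite pE doubleS addn3 -muln2 mulnAC.
  rewrite dvdE natrM addn1 addn2 lucas_mul_succ.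
  by rewrite -pE2 Lp exprS exprM sqrrN expr1n expr1n mulr1 subrr.
Qed.
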